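(* Let $G(z)=\sum_{p=0}^{d}z^pA_p+\sum_{j=1}^k w_j(z)E_j$ be an $n\times n$ rational matrix polynomial and let $\lambda\in\mathbb{C}$ be such that $\lambda$ is not a pole of $G(z)$ and $w_j(\lambda)\ne0$ for $j=1,\ldots,k$. Suppose that $M:=(G(\lambda))^{-1}$ exists. Then $$\eta^{\mathrm{sym}}(G,\lambda)=\eta(G,\lambda)=\frac{\sigma_{\min}(G(\lambda))}{\|(1,\lambda,\ldots,\lambda^d,w_1(\lambda),\ldots,w_k(\lambda))\|}.$$
   Context: A rational matrix polynomial (RMP) is $G(z)=\sum_{p=0}^d z^pA_p+\sum_{j=1}^k w_j(z)E_j$ with $A_p,E_j\in\mathbb{C}^{n\times n}$ and $w_j(z)=s_j(z)/q_j(z)$, where $s_j,q_j$ are scalar polynomials, $q_j\not\equiv0$. The poles of $G(z)$ are the roots of the $q_j$. $\|\cdot\|$ is the spectral norm (Euclidean norm for vectors); $\sigma_{\min}$ is the smallest singular value. For a tuple of $n\times n$ matrices, the tuple norm is $$|||(\Delta A_0,\ldots,\Delta A_d,\Delta E_1,\ldots,\Delta E_k)|||:=\sqrt{\textstyle\sum_{p=0}^d\|\Delta A_p\|^2+\sum_{j=1}^k\|\Delta E_j\|^2}.$$ For $\mathbb{S}\subseteq(\mathbb{C}^{n\times n})^{d+k+1}$ the structured eigenvalue backward error $\eta^{\mathbb{S}}(G,\lambda)$ is the infimum of $|||(\Delta A_0,\ldots,\Delta E_k)|||$ over all $(\Delta A_0,\ldots,\Delta A_d,\Delta E_1,\ldots,\Delta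 E_k)\in\mathbb{S}$ with $$\det\Big(\sum_{p=0}^d\lambda^p(A_p-\Delta A_p)+\sum_{j=1}^kw_j(\lambda)(E_j-\Delta E_j)\Big)=0.$$ $\eta^{\mathrm{sym}}(G,\lambda)$ denotes $\eta^{\mathbb{S}}(G,\lambda)$ when $\mathbb{S}$ is the set of tuples of symmetric ($X^T=X$) complex $n\times n$ matrices, and $\eta(G,\lambda)$ denotes $\eta^{\mathbb{S}}(G,\lambda)$ for $\mathbb{S}=(\mathbb{C}^{n\times n})^{d+k+1}$. *)

(* Defs.v *)
From mathcomp Require Import all_boot all_order all_algebra.
From mathcomp Require Import spectral.
From mathcomp Require Import complex.
From mathcomp Require Import all_classical all_reals.
From mathcomp Require Import ereal.

Set Implicit Arguments.
Unset Strict Implicit.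
Unset Printing Implicit Defensive.

Import Order.TTheory GRing.Theory Num.Theory.
Local Open Scope ring_scope.
Local Open Scope complex_scope.
Local Open Scope classical_set_scope.
Local Open Scope sesquilinear_scope.

Section MatrixNorms.
Variable R : realType.

Definition vnorm (n : nat) (x : 'cV[R[i]]_n) : R :=
  Num.sqrt (\sum_(i < n) Normc.normc (x i 0) ^+ 2).

(* For n = 0 there is no unit vector; the value is then sup set0 = 0. *)
Definition spectral_norm (n : nat) (A : 'M[R[i]]_n) : R :=
  sup [set vnorm (A *m x) | x in [set x : 'cV[R[i]]_n | vnorm x = 1]].

Definition singular_values (n : nat) (A : 'M[R[i]]_n) : set R :=
  [set s : R | 0 <= s /\ eigenvalue (A ^t* *m A) (s ^+ 2)%:C].

(* singular_values A is finite, and nonempty when 0 < n, so that this infimum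
   is attained. *)
Definition sigma_min (n : nat) (A : 'M[R[i]]_n) : R := inf (singular_values A).

End MatrixNorms.

(* G(z) = \sum_(p <= d) z^p A_p + \sum_(j < k) s_j(z) / q_j(z) E_j; the
   fractions are not assumed to be in lowest terms. *)
Record rmp (R : realType) (n d k : nat) := Rmp {
  rmp_A : 'I_d.+1 -> 'M[R[i]]_n ;
  rmp_E : 'I_k -> 'M[R[i]]_n ;
  rmp_s : 'I_k -> {poly R[i]} ;
  rmp_q : 'I_k -> {poly R[i]} ;
  rmp_q_neq0 : forall j, rmp_q j != 0 }.

Section BackwardError.
Variables (R : realType) (n d k : nat).
Implicit Types (G : rmp R n d k) (z : R[i]).

Definition rmp_w G (j : 'I_k) z : R[i] := (rmp_s G j).[z] / (rmp_q G j).[z].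

Definition rmp_eval G z : 'M[R[i]]_n :=
  \sum_(p < d.+1) z ^+ p *: rmp_A G p + \sum_(j < k) rmp_w G j z *: rmp_E G j.

Definition rmp_pole G z : Prop := exists j : 'I_k, root (rmp_q G j) z.

Definition rmp_weights G z : 'cV[R[i]]_(d.+1 + k) :=
  col_mx (\col_(p < d.+1) z ^+ p) (\col_(j < k) rmp_w G j z).

Definition perturbation : Type :=
  (('I_d.+1 -> 'M[R[i]]_n) * ('I_k -> 'M[R[i]]_n))%type.

Definition tuple_norm (D : perturbation) : R :=
  Num.sqrt (\sum_(p < d.+1) spectral_norm (D.1 p) ^+ 2
            + \sum_(j < k) spectral_norm (D.2 j) ^+ 2).

Definition rmp_perturb G (D : perturbation) : rmp R n d k :=
  @Rmp R n d k (fun p => rmp_A G p - D.1 p) (fun j => rmp_E G j - D.2 j)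
    (rmp_s G) (rmp_q G) (rmp_q_neq0 G).

Definition backward_error (S : set perturbation) G z : \bar R :=
  ereal_inf [set (tuple_norm D)%:E |
    D in [set D | S D /\ \det (rmp_eval (rmp_perturb G D) z) = 0]].

Definition sym_perturbations : set perturbation :=
  [set D | (forall p, (D.1 p)^T = D.1 p) /\ (forall j, (D.2 j)^T = D.2 j)].

Definition eta_sym G z : \bar R := backward_error sym_perturbations G z.

Definition eta G z : \bar R := backward_error setT G z.

End BackwardError.

(* Main.v *)
Require Import Defs.
From mathcomp Require Import all_boot all_order all_algebra.
From mathcomp Require Import spectral sesquilinear.
From mathcomp Require Import complex.
From mathcomp Require Import ring.
From mathcomp Require Import all_classical all_reals.
From mathcomp Require Import ereal.

(** A perturbation makes G(lambda) singular exactly when its weighted sum agrees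
    with G(lambda) at some nonzero vector, and symmetric perturbations can
    achieve this at no extra cost.

    Write w for the vector of weights (1, lambda, ..., w_k(lambda)), and
    Delta_i for the perturbation of the i-th coefficient.

    Lower bound.  A singular perturbed value gives x <> 0 with
    G(lambda) x = \sum_i w_i Delta_i x.  The left-hand side has norm at least
    sigma_min |x| ([sigma_min_variational]).  By Cauchy-Schwarz the right-hand
    side has norm at most |w| (\sum_i |Delta_i x|^2)^(1/2)
    ([sqr_vnorm_lincomb]), hence at most |w| times the tuple norm times |x|.
    Therefore the tuple norm is at least sigma_min / |w|
    ([sigma_min_le_tuple_norm]).

    Attainment.  Let x be a unit vector with |G(lambda) x| = sigma_min.  Between
    any two unit vectors there is a symmetric contraction S
    ([symmetric_contraction]); choose S x = G(lambda) x / sigma_min.  Then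
    sigma_min S agrees with G(lambda) at x.  Distributing sigma_min S over the
    coefficients in proportion to the conjugate weights,
    Delta_i = (w_i^* / |w|^2) sigma_min S, is the equality case of
    Cauchy-Schwarz, so the tuple norm is at most sigma_min / |w|
    ([exists_optimal_symmetric]).

    This perturbation is admissible for both backward errors, so both equal
    sigma_min / |w|. *)

Set Implicit Arguments.
Unset Strict Implicit.
Unset Printing Implicit Defensive.

Import Order.TTheory GRing.Theory Num.Theory.
Local Open Scope ring_scope.

(** * Symmetric matrices with a prescribed image *)

Section SymmetricTransfer.
Local Open Scope sesquilinear_scope.
Variable (C : numClosedFieldType).
Local Notation "''[' u , v ]" := (dotmx u v) : ring_scope.
Local Notation "''[' u ]" := '[u, u]%R : ring_scope.

Lemma mul_row_tr n (v u : 'rV[C]_n) : v *m u^T = '[v, map_mx Num.conj u]%:M.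
Proof.
rewrite [LHS]mx11_scalar dotmxE; congr (_%:M); rewrite !mxE.
by apply: eq_bigr => i _; rewrite !mxE conjCK.
Qed.

Lemma dnorm_conj n (v : 'rV[C]_n) : '[map_mx Num.conj v] = '[v].
Proof.
by rewrite !dotmxE !mxE; apply: eq_bigr => i _; rewrite !mxE conjCK mulrC.
Qed.

Lemma dnorm_lincomb n (e f : 'rV[C]_n) (a b : C) : '[e, f] = 0 -> '[e] = 1 ->
  '[a *: e + b *: f] = `|a| ^+ 2 + `|b| ^+ 2 * '[f].
Proof.
move=> ef e1; rewrite hnormDd /=.
  by rewrite !dnormZ /= e1 mulr1.
by rewrite linearZl_LR linearZr_LR /= ef !mulr0.
Qed.

(** Only |f| <= 1 is asked, so that f may be either a unit vector or zero. *)
Lemma bessel_pair n (v e f : 'rV[C]_n) : '[e, f] = 0 -> '[e] = 1 -> '[f] <= 1 ->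
  `|'[v, e]| ^+ 2 + `|'[v, f]| ^+ 2 <= '[v].
Proof.
move=> ef e1 f1; set a := '[v, e]; set b := '[v, f].
pose w := a *: e + b *: f.
have nw : '[w] = `|a| ^+ 2 + `|b| ^+ 2 * '[f] by apply: dnorm_lincomb.
have vw : '[v, w] = `|a| ^+ 2 + `|b| ^+ 2.
  by rewrite linearDr /= !linearZr_LR /= -/a -/b !normCK ![_^* * _]mulrC.
have : 0 <= '[v - w] by apply: dnorm_ge0.
rewrite dnormB /= vw nw rmorphD /= !rmorphXn /= !conj_normC.
set p := `|a| ^+ 2; set q := `|b| ^+ 2 => h.
have qf : q * '[f] <= q by rewrite ler_piMr ?exprn_ge0.
rewrite -subr_ge0; apply: le_trans h _; rewrite -subr_ge0.
have -> : '[v] - (p + q) - ('[v] + (p + q * '[f]) - (p + q + (p + q)))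
        = q - q * '[f] by ring.
by rewrite subr_ge0.
Qed.

Lemma mul_row_symmetric n (v u r : 'rV[C]_n) (a b c : C) :
  v *m (a *: (u^T *m u) + b *: (r^T *m u + u^T *m r) - c *: (r^T *m r)) =
    (a * '[v, map_mx Num.conj u] + b * '[v, map_mx Num.conj r]) *: u
  + (b * '[v, map_mx Num.conj u] - c * '[v, map_mx Num.conj r]) *: r.
Proof.
rewrite mulmxBr !mulmxDr -!scalemxAr !mulmxDr !mulmxA !mul_row_tr.
by rewrite !mul_scalar_mx scalerDr !scalerDl !scaleNr !scalerA !addrA.
Qed.

Lemma tr_row_symmetric n (u r : 'rV[C]_n) (a b c : C) :
  let S := a *: (u^T *m u) + b *: (r^T *m u + u^T *m r) - c *: (r^T *m r) in
  S^T = S.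
Proof.
rewrite /= linearB linearD !linearZ linearD /= !trmx_mul !trmxK.
by rewrite (addrC (u^T *m r)).
Qed.

(** Write y = c u + s r, where u is the conjugate of x and r is a unit vector
    orthogonal to u.  Then S = U [[c, s], [s, - c^*]] U^T, where U has the
    orthonormal columns u^T and r^T.  The middle matrix is symmetric, and it is
    unitary because |c|^2 + s^2 = |y|^2 = 1; its first row (c, s) makes x, for
    which x U = (1, 0), go to y.  When y is a multiple of u, both s and r
    vanish and the same formula still gives a contraction. *)
Lemma symmetric_transfer n (x y : 'rV[C]_n) : '[x] = 1 -> '[y] = 1 ->
  exists S : 'M[C]_n, [/\ S^T = S, x *m S = y & forall v, '[v *m S] <= '[v]].
Proof.
move=> x1 y1; pose u := map_mx Num.conj x.
pose c := '[y, u]; pose z := y - c *: u.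
pose s := sqrtC '[z]; pose r := s^-1 *: z.
have u1 : '[u] = 1 by rewrite dnorm_conj.
have uC : map_mx Num.conj u = x by apply/matrixP=> i j; rewrite !mxE conjCK.
have zu : '[z, u] = 0 by rewrite linearBl /= linearZl_LR /= u1 mulr1 subrr.
have s_ge0 : 0 <= s by rewrite sqrtC_ge0 dnorm_ge0.
have sC : s^* = s by apply/CrealP/ger0_real.
have s2 : s ^+ 2 = '[z] by rewrite sqrtCK.
have sr : s *: r = z.
  have [s0|s0] := eqVneq s 0; last by rewrite scalerA divff ?scale1r.
  by move/eqP: s2; rewrite s0 scale0r expr0n /= eq_sym dnorm_eq0 => /eqP.
have ru : '[r, u] = 0 by rewrite linearZl_LR /= zu mulr0.
have r_le1 : '[r] <= 1.
  rewrite dnormZ /= normfV (ger0_norm s_ge0) -s2 exprVn.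
  by have [->|s0] := eqVneq s 0; rewrite ?expr0n /= ?mulr0 ?mulVf ?expf_neq0.
have cs : `|c| ^+ 2 + s ^+ 2 = 1.
  rewrite -y1 s2.
  have -> : '[y] = '[z + c *: u] by rewrite subrK.
  have -> : '[z + c *: u] = '[z] + '[c *: u].
    by apply: hnormDd; rewrite linearZr_LR /= zu mulr0.
  by rewrite dnormZ /= u1 mulr1 addrC.
have xrC : '[x, map_mx Num.conj r] = 0.
  rewrite -ru !dotmxE !mxE.
  by apply: eq_bigr => i _; rewrite !mxE !conjCK mulrC.
pose S := c *: (u^T *m u) + s *: (r^T *m u + u^T *m r) - c^* *: (r^T *m r).
have vS v : v *m S = (c * '[v, x] + s * '[v, map_mx Num.conj r]) *: u
                   + (s * '[v, x] - c^* * '[v, map_mx Num.conj r]) *: r.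
  by rewrite mul_row_symmetric uC.
exists S; split.
- exact: tr_row_symmetric.
- by rewrite vS x1 xrC !mulr0 !mulr1 addr0 subr0 sr addrC subrK.
move=> v; rewrite vS; set a := '[v, x]; set b := '[v, _].
have ur : '[u, r] = 0 by rewrite hermC /= ru rmorph0 mulr0.
rewrite dnorm_lincomb //.
apply: (@le_trans _ _ (`|a| ^+ 2 + `|b| ^+ 2)); last first.
  by apply: bessel_pair; rewrite // dnorm_conj.
apply: (@le_trans _ _ (`|c * a + s * b| ^+ 2 + `|s * a - c^* * b| ^+ 2)).
  by rewrite lerD2l ler_piMr ?exprn_ge0.
(* The two sides are equal: this is the unitarity of the middle matrix. *)
rewrite le_eqVlt; apply/orP; left; apply/eqP.
rewrite -[RHS]mul1r -cs !normCK !(rmorphD, rmorphN, rmorphM) /= conjCK sC.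
ring.
Qed.
End SymmetricTransfer.

Local Open Scope complex_scope.

(** * The Euclidean norm *)

Section EuclideanNorm.
Local Open Scope sesquilinear_scope.
Variable R : realType.
Local Notation C := R[i].

Lemma vnorm_ge0 n (x : 'cV[C]_n) : 0 <= vnorm x.
Proof. exact: sqrtr_ge0. Qed.

Lemma sqr_vnorm n (x : 'cV[C]_n) :
  vnorm x ^+ 2 = \sum_i Normc.normc (x i 0) ^+ 2.
Proof. by rewrite sqr_sqrtr // sumr_ge0 // => i _; rewrite sqr_ge0. Qed.

Lemma real_sqr_normc (z : C) : (Normc.normc z ^+ 2)%:C = `|z| ^+ 2.
Proof. by rewrite rmorphXn. Qed.

Lemma normc_ge0 (z : C) : 0 <= Normc.normc z.
Proof. by case: z => u v; apply: sqrtr_ge0. Qed.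

Lemma normc_real (a : R) : 0 <= a -> Normc.normc a%:C = a.
Proof. by move=> a0; rewrite /= expr0n addr0 sqrtr_sqr ger0_norm. Qed.

Lemma sqr_vnormC n (x : 'cV[C]_n) : (vnorm x ^+ 2)%:C = dotmx x^T x^T.
Proof.
rewrite sqr_vnorm rmorph_sum dotmxE mxE; apply: eq_bigr => i _ /=.
by rewrite !mxE -normCK real_sqr_normc.
Qed.

Lemma sqr_vnorm_adj n (x : 'cV[C]_n) : (vnorm x ^+ 2)%:C = (x ^t* *m x) 0 0.
Proof.
rewrite sqr_vnormC dotmxE !mxE; apply: eq_bigr => i _.
by rewrite !mxE mulrC.
Qed.

Lemma vnorm_eq0 n (x : 'cV[C]_n) : (vnorm x == 0) = (x == 0).
Proof.
rewrite -sqrf_eq0 -(inj_eq (@complexI R)) sqr_vnormC.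
by rewrite dnorm_eq0 -(inj_eq trmx_inj) trmx0.
Qed.

Lemma vnorm_gt0 n (x : 'cV[C]_n) : (0 < vnorm x) = (x != 0).
Proof. by rewrite lt_def vnorm_eq0 vnorm_ge0 andbT. Qed.

Lemma vnorm0 n : vnorm (0 : 'cV[C]_n) = 0.
Proof. by apply/eqP; rewrite vnorm_eq0. Qed.

Lemma vnorm_delta n (i : 'I_n) : vnorm (delta_mx i 0 : 'cV[C]_n) = 1.
Proof.
apply/eqP; rewrite -(@eqrXn2 _ 2) ?vnorm_ge0 // sqr_vnorm expr1n.
rewrite (bigD1 i) //= big1 => [|j ji]; last first.
  by rewrite mxE (negPf ji) /= !expr0n addr0 sqrtr0 expr0n.
by rewrite mxE !eqxx /= expr0n addr0 expr1n addr0 sqrtr1 expr1n.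
Qed.

Lemma vnormZ n (a : C) (x : 'cV[C]_n) :
  vnorm (a *: x) = Normc.normc a * vnorm x.
Proof.
apply/eqP; rewrite -(@eqrXn2 _ 2) ?mulr_ge0 ?vnorm_ge0 ?normc_ge0 //.
apply/eqP; rewrite exprMn !sqr_vnorm mulr_sumr; apply: eq_bigr => i _.
by rewrite mxE Normc.normcM exprMn.
Qed.

Lemma vnorm_normalize n (x : 'cV[C]_n) : x != 0 ->
  vnorm ((vnorm x)^-1%:C *: x) = 1.
Proof.
move=> x0; rewrite vnormZ normc_real ?invr_ge0 ?vnorm_ge0 //.
by rewrite mulVf // vnorm_eq0.
Qed.

(** Cauchy-Schwarz in each coordinate, summed over the coordinates.  It bounds
    both \sum_i w_i Delta_i x and, with the columns of A as the vectors, A x. *)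
Lemma sqr_vnorm_lincomb n m (w : 'cV[C]_m) (u : 'I_m -> 'cV[C]_n) :
  vnorm (\sum_p w p 0 *: u p) ^+ 2 <= vnorm w ^+ 2 * \sum_p vnorm (u p) ^+ 2.
Proof.
under [X in _ * X]eq_bigr do rewrite sqr_vnorm.
rewrite exchange_big /= mulr_sumr sqr_vnorm; apply: ler_sum => i _.
rewrite -lecR real_sqr_normc rmorphM /= sqr_vnormC.
pose v := \row_p (u p i 0)^*%R.
have -> : (\sum_p w p 0 *: u p) i 0 = dotmx w^T v.
  rewrite summxE dotmxE mxE; apply: eq_bigr => p _.
  by rewrite !mxE conjCK.
have -> : (\sum_p Normc.normc (u p i 0) ^+ 2)%:C = dotmx v v.
  rewrite rmorph_sum dotmxE mxE; apply: eq_bigr => p _.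
  by rewrite !mxE conjCK [RHS]mulrC /= -normCK real_sqr_normc.
by apply: (CauchySchwarz (@dotmx C m) w^T v).
Qed.

End EuclideanNorm.

(** * The spectral norm *)

Section SpectralNorm.
Local Open Scope classical_set_scope.
Variable R : realType.
Local Notation C := R[i].

Lemma mulmx_sum_col m n (A : 'M[C]_(m, n)) (x : 'cV[C]_n) :
  A *m x = \sum_j x j 0 *: col j A.
Proof.
apply/matrixP => i k; rewrite !mxE summxE; apply: eq_bigr => j _.
by rewrite !mxE mulrC (ord1 k).
Qed.

(** Needed before the supremum can be used: [sup] is 0 on unbounded sets.  The
    Frobenius norm is the upper bound. *)
Lemma spectral_norm_has_sup n (A : 'M[C]_n) : (0 < n)%N ->
  has_sup [set vnorm (A *m x) | x in [set x : 'cV[C]_n | vnorm x = 1]].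
Proof.
case: n A => // n A _; split.
  exists (vnorm (A *m delta_mx 0 0)), (delta_mx 0 0) => //=.
  exact: vnorm_delta.
exists (Num.sqrt (\sum_j vnorm (col j A) ^+ 2)) => _ [x /= x1 <-].
rewrite -(ger0_norm (vnorm_ge0 _)) -sqrtr_sqr ler_wsqrtr // mulmx_sum_col.
by apply: le_trans (sqr_vnorm_lincomb _ _) _; rewrite x1 expr1n mul1r.
Qed.

Lemma vnorm_mul_le n (A : 'M[C]_n) (x : 'cV[C]_n) : (0 < n)%N ->
  vnorm (A *m x) <= spectral_norm A * vnorm x.
Proof.
move=> n0; have [->|x0] := eqVneq x 0.
  by rewrite mulmx0 !vnorm0 mulr0.
have x_gt0 : 0 < vnorm x by rewrite vnorm_gt0.
rewrite -ler_pdivrMr //.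
have -> : vnorm (A *m x) / vnorm x = vnorm (A *m ((vnorm x)^-1%:C *: x)).
  by rewrite -scalemxAr vnormZ normc_real ?invr_ge0 ?vnorm_ge0 // mulrC.
apply: (ub_le_sup (spectral_norm_has_sup A n0).2).
by exists ((vnorm x)^-1%:C *: x) => //=; apply: vnorm_normalize.
Qed.

Lemma spectral_norm_le n (A : 'M[C]_n) (c : R) : (0 < n)%N ->
  (forall x, vnorm (A *m x) <= c * vnorm x) -> spectral_norm A <= c.
Proof.
move=> n0 h; apply: ge_sup (spectral_norm_has_sup A n0).1 _.
by move=> _ [x /= x1 <-]; rewrite (le_trans (h x)) // x1 mulr1.
Qed.

Lemma spectral_norm_ge0 n (A : 'M[C]_n) : 0 <= spectral_norm A.
Proof.
pose S := [set vnorm (A *m x) | x in [set x : 'cV[C]_n | vnorm x = 1]].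
rewrite -[spectral_norm A]/(sup S).
have [hs|nhs] := pselect (has_sup S); last by rewrite sup_out.
have [_ [x x1 _]] := hs.1.
by apply: le_trans (vnorm_ge0 (A *m x)) _; apply: ub_le_sup hs.2 _ _; exists x.
Qed.

End SpectralNorm.

(** * The smallest singular value *)

Section SigmaMin.
Local Open Scope sesquilinear_scope.
Local Open Scope classical_set_scope.
Variable R : realType.
Local Notation C := R[i].

Lemma sqr_vnorm_mul n (A : 'M[C]_n) (x : 'cV[C]_n) :
  (vnorm (A *m x) ^+ 2)%:C = (x ^t* *m (A ^t* *m A) *m x) 0 0.
Proof. by rewrite sqr_vnorm_adj trmx_mul map_mxM !mulmxA. Qed.

Lemma vnorm_unitary n (P : 'M[C]_n) (x : 'cV[C]_n) : P \is unitarymx ->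
  vnorm (P *m x) = vnorm x.
Proof.
move=> Pu; have PP : P ^t* *m P = 1%:M by apply/mulmx1C/unitarymxP.
apply/eqP; rewrite -(@eqrXn2 _ 2) ?vnorm_ge0 // -(inj_eq (@complexI R)).
by rewrite sqr_vnorm_mul PP mulmx1 -sqr_vnorm_adj.
Qed.

(** The right half of a singular value decomposition, from the unitary
    diagonalization P of A^* A.  The i-th value is the norm of A at the i-th
    vector of the eigenbasis, which makes it visibly real and nonnegative. *)
Lemma singular_basis n (A : 'M[C]_n) :
  exists P (a : 'I_n -> R), [/\ P \is unitarymx,
    forall i, singular_values A (a i) &
    forall x, vnorm (A *m x) ^+ 2
              = \sum_i a i ^+ 2 * Normc.normc ((P *m x) i 0) ^+ 2].
Proof.
pose H := A ^t* *m A; pose P := spectralmx H; pose d := spectral_diag H.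
have Pu : P \is unitarymx by apply: spectral_unitarymx.
have HE : H = P ^t* *m diag_mx d *m P.
  rewrite -invmx_unitary //; apply/orthomx_spectralP/normalmxP.
  by rewrite /H trmx_mul map_mxM trmxCK.
have PH : P *m H = diag_mx d *m P.
  by rewrite HE !mulmxA (unitarymxP Pu) mul1mx.
have normA x : (vnorm (A *m x) ^+ 2)%:C
             = \sum_i d 0 i * `|(P *m x) i 0| ^+ 2.
  rewrite sqr_vnorm_mul -/H HE.
  have -> : x ^t* *m (P ^t* *m diag_mx d *m P) *m x
          = (P *m x) ^t* *m (diag_mx d *m (P *m x)).
    by rewrite trmx_mul map_mxM !mulmxA.
  rewrite mxE; apply: eq_bigr => i _.
  by rewrite mul_diag_mx !mxE normCK mulrCA [in RHS](mulrC _ (_^*)%R).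
pose e i : 'cV[C]_n := (row i P) ^t*.
have Pe i : P *m e i = delta_mx i 0.
  rewrite /e tr_row map_col colE mulmxA (unitarymxP Pu).
  by rewrite mul1mx.
have dE i : d 0 i = (vnorm (A *m e i) ^+ 2)%:C.
  rewrite normA Pe (bigD1 i) //= big1 => [|j ji].
    by rewrite mxE !eqxx normr1 expr1n mulr1 addr0.
  by rewrite mxE (negPf ji) normr0 expr0n mulr0.
exists P, (fun i => vnorm (A *m e i)); split => // [i|x].
  split; first exact: vnorm_ge0.
  rewrite -dE; apply/eigenvalueP; exists (row i P).
    by rewrite -row_mul PH row_mul row_diag_mx -scalemxAl -rowE.
  apply/eqP => r0; have := row_unitarymxP Pu i i.
  by rewrite r0 linear0l eqxx => /eqP; rewrite eq_sym oner_eq0.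
apply: (@complexI R); rewrite normA rmorph_sum; apply: eq_bigr => i _ /=.
by rewrite dE -real_sqr_normc -rmorphM.
Qed.

(** For a unit vector x, |A x|^2 is the average of the squared singular values,
    weighted by the squared moduli of the coordinates of x in a basis of right
    singular vectors.  That average is smallest at a basis vector; applied to
    an eigenvector of A^* A, the bound shows that no singular value lies below
    the least one listed. *)
Lemma sigma_min_variational n (A : 'M[C]_n) : (0 < n)%N ->
  (forall x, sigma_min A * vnorm x <= vnorm (A *m x)) /\
  (exists2 x, vnorm x = 1 & vnorm (A *m x) = sigma_min A).
Proof.
move=> n0; have [P [a [Pu aS aE]]] := singular_basis A.
have a_ge0 i : 0 <= a i by case: (aS i).
have [i0 amin] : exists i0, forall i, a i0 <= a i.
  case: (arg_minP a (erefl true : xpredT (Ordinal n0))) => i _ h.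
  by exists i => j; apply: h.
have low x : a i0 * vnorm x <= vnorm (A *m x).
  rewrite -(@ler_pXn2r _ 2) ?nnegrE ?mulr_ge0 ?vnorm_ge0 // exprMn aE.
  rewrite -(vnorm_unitary x Pu) sqr_vnorm mulr_sumr; apply: ler_sum => i _.
  by rewrite ler_wpM2r ?sqr_ge0 // ler_pXn2r ?nnegrE.
have smin : sigma_min A = a i0.
  apply/eqP; rewrite eq_le; apply/andP; split.
    by apply: ge_inf; [exists 0 => s [] | apply: aS].
  apply: lb_le_inf; first by exists (a i0); apply: aS.
  (* [eigenvalue] is about row vectors v, whence the test vector v^*. *)
  move=> s [s_ge0 /eigenvalueP [v vH v0]].
  have x0 : v ^t* != 0.
    by apply: contra_neq v0 => vC; rewrite -(trmxCK v) vC trmx0 map_mx0.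
  have x_gt0 : 0 < vnorm (v ^t*) by rewrite vnorm_gt0.
  suff E : vnorm (A *m v ^t*) = s * vnorm (v ^t*).
    by have := low (v ^t*); rewrite E ler_pM2r.
  apply/eqP; rewrite -(@eqrXn2 _ 2) ?mulr_ge0 ?vnorm_ge0 //.
  apply/eqP/(@complexI R); rewrite sqr_vnorm_mul trmxCK vH -scalemxAl mxE.
  by rewrite exprMn (rmorphM (real_complex R) (s ^+ 2)) /= sqr_vnorm_adj trmxCK.
split=> [x|]; first by rewrite smin.
have Pe : P *m (P ^t* *m delta_mx i0 0) = delta_mx i0 0 :> 'cV[C]_n.
  by rewrite mulmxA (unitarymxP Pu) mul1mx.
exists (P ^t* *m delta_mx i0 0).
  by rewrite -(vnorm_unitary _ Pu) Pe vnorm_delta.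
apply/eqP; rewrite smin -(@eqrXn2 _ 2) ?vnorm_ge0 // aE Pe.
rewrite (bigD1 i0) //= big1 => [|j ji]; last first.
  by rewrite mxE (negPf ji) /= !expr0n addr0 sqrtr0 expr0n mulr0.
by rewrite mxE !eqxx /= expr0n addr0 expr1n addr0 sqrtr1 expr1n mulr1.
Qed.

End SigmaMin.

Lemma symmetric_contraction (R : realType) n (x y : 'cV[R[i]]_n) :
  vnorm x = 1 -> vnorm y = 1 ->
  exists S : 'M[R[i]]_n,
    [/\ S^T = S, S *m x = y & forall v, vnorm (S *m v) <= vnorm v].
Proof.
move=> x1 y1; have [||S [ST xS Sle]] := @symmetric_transfer _ n x^T y^T.
- by rewrite -sqr_vnormC x1 expr1n.
- by rewrite -sqr_vnormC y1 expr1n.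
exists S; split=> // [|v].
  by apply: trmx_inj; rewrite trmx_mul ST.
rewrite -(@ler_pXn2r _ 2) ?nnegrE ?vnorm_ge0 // -lecR !sqr_vnormC.
by rewrite trmx_mul ST.
Qed.

(** * Perturbations of a rational matrix polynomial *)

Section Perturbation.
Variables (R : realType) (n d k : nat).
Implicit Types (G : rmp R n d k) (D : perturbation R n d k) (z : R[i]).

(** The two families of a perturbation as a single one indexed like
    [rmp_weights], so that Cauchy-Schwarz applies to the pairing with the
    weights. *)
Definition perturbation_coef D (i : 'I_(d.+1 + k)) : 'M[R[i]]_n :=
  match fintype.split i with inl p => D.1 p | inr j => D.2 j end.

Lemma perturbation_coef_lshift D p : perturbation_coef D (lshift k p) = D.1 p.
Proof. by rewrite /perturbation_coef (unsplitK (inl p)). Qed.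

Lemma perturbation_coef_rshift D j :
  perturbation_coef D (rshift d.+1 j) = D.2 j.
Proof. by rewrite /perturbation_coef (unsplitK (inr j)). Qed.

Definition perturbation_of (F : 'I_(d.+1 + k) -> 'M[R[i]]_n) :
    perturbation R n d k :=
  (fun p => F (lshift k p), fun j => F (rshift d.+1 j)).

Lemma perturbation_ofK F : perturbation_coef (perturbation_of F) =1 F.
Proof.
move=> i; rewrite /perturbation_coef /perturbation_of.
by case: splitP => j ij /=; congr F; apply: val_inj.
Qed.

Lemma sqr_tuple_norm D :
  tuple_norm D ^+ 2 = \sum_i spectral_norm (perturbation_coef D i) ^+ 2.
Proof.
rewrite sqr_sqrtr ?addr_ge0 ?sumr_ge0 // => [|i _|i _]; rewrite ?sqr_ge0 //.
rewrite big_split_ord /=.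
under [X in _ = X + _]eq_bigr do rewrite perturbation_coef_lshift.
by under [X in _ = _ + X]eq_bigr do rewrite perturbation_coef_rshift.
Qed.

Lemma rmp_eval_perturb G D z :
  rmp_eval (rmp_perturb G D) z =
  rmp_eval G z - \sum_i rmp_weights G z i 0 *: perturbation_coef D i.
Proof.
rewrite /rmp_eval big_split_ord /= opprD addrACA -!sumrB.
congr (_ + _); apply: eq_bigr => i _.
  by rewrite perturbation_coef_lshift col_mxEu mxE scalerBr.
by rewrite perturbation_coef_rshift col_mxEd mxE scalerBr.
Qed.

(** The coefficient A_0 has weight 1. *)
Lemma vnorm_weights_gt0 G z : 0 < vnorm (rmp_weights G z).
Proof.
rewrite vnorm_gt0; apply/eqP.
move/colP/(_ (lshift k ord0)); rewrite col_mxEu !mxE expr0.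
by apply/eqP; rewrite oner_eq0.
Qed.

(** A kernel vector x of the perturbed matrix satisfies
    G(z) x = \sum_i w_i Delta_i x; compare the norms of the two sides. *)
Lemma sigma_min_le_tuple_norm G D z : (0 < n)%N ->
  \det (rmp_eval (rmp_perturb G D) z) = 0 ->
  sigma_min (rmp_eval G z) / vnorm (rmp_weights G z) <= tuple_norm D.
Proof.
move=> n0; rewrite -det_tr => /eqP/det0P [v v0 vM].
have w0 := vnorm_weights_gt0 G z.
have xM : rmp_eval (rmp_perturb G D) z *m v^T = 0.
  by apply: trmx_inj; rewrite trmx_mul trmxK vM trmx0.
have x0 : v^T != 0 by apply: contra_neq v0 => vT; rewrite -(trmxK v) vT trmx0.
set x := v^T in xM x0; clearbody x.
have x_gt0 : 0 < vnorm x by rewrite vnorm_gt0.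
have Gx : rmp_eval G z *m x
        = \sum_i rmp_weights G z i 0 *: (perturbation_coef D i *m x).
  apply/eqP; rewrite -subr_eq0; apply/eqP; rewrite -[RHS]xM rmp_eval_perturb.
  rewrite mulmxBl mulmx_suml; congr (_ - _).
  by apply: eq_bigr => i _; rewrite scalemxAl.
have T0 : 0 <= tuple_norm D by apply: sqrtr_ge0.
rewrite ler_pdivrMr // -(ler_pM2r x_gt0).
apply: le_trans ((sigma_min_variational (rmp_eval G z) n0).1 x) _.
rewrite -(@ler_pXn2r _ 2) ?nnegrE ?mulr_ge0 ?vnorm_ge0 // Gx.
apply: le_trans (sqr_vnorm_lincomb _ _) _.
rewrite [tuple_norm D * _]mulrC !exprMn -mulrA ler_wpM2l ?sqr_ge0 //.
rewrite sqr_tuple_norm mulr_suml; apply: ler_sum => i _.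
rewrite -exprMn ler_pXn2r ?nnegrE ?mulr_ge0 ?vnorm_ge0 ?spectral_norm_ge0 //.
exact: vnorm_mul_le.
Qed.

(** The lower bound is tight when all Delta_i x are parallel and their sizes
    are proportional to the weights.  So a single symmetric contraction S is
    shared among the coefficients with factors proportional to w_i^*. *)
Lemma exists_optimal_symmetric G z : (0 < n)%N -> rmp_eval G z \in unitmx ->
  exists D, [/\ sym_perturbations D,
    \det (rmp_eval (rmp_perturb G D) z) = 0 &
    tuple_norm D <= sigma_min (rmp_eval G z) / vnorm (rmp_weights G z)].
Proof.
move=> n0 Gu; set M := rmp_eval G z in Gu *; set w := rmp_weights G z.
have w_gt0 : 0 < vnorm w := vnorm_weights_gt0 G z.
have [_ [x x1 Mx]] := sigma_min_variational M n0.
set s := sigma_min M in Mx *.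
have s_gt0 : 0 < s.
  rewrite -Mx vnorm_gt0; apply/eqP => Mx0.
  have : vnorm x = 0 by rewrite -[x](mulKmx Gu) Mx0 mulmx0 vnorm0.
  by rewrite x1 => /eqP; rewrite oner_eq0.
have y1 : vnorm (s^-1%:C *: (M *m x)) = 1.
  by rewrite -Mx vnorm_normalize // -vnorm_eq0 Mx gt_eqF.
have [S [ST Sx Sle]] := symmetric_contraction x1 y1.
pose c := s / vnorm w ^+ 2.
have c_ge0 : 0 <= c by rewrite divr_ge0 ?sqr_ge0 // ltW.
pose F i : 'M[R[i]]_n := ((w i 0)^*%R * c%:C) *: S.
have FT i : (F i)^T = F i by rewrite linearZ /= ST.
exists (perturbation_of F); split.
- by split=> i; apply: FT.
- rewrite rmp_eval_perturb -/M -/w.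
  under eq_bigr do
    rewrite perturbation_ofK scalerA mulrA -normCK -real_sqr_normc.
  rewrite -scaler_suml -mulr_suml -rmorph_sum -sqr_vnorm -rmorphM.
  rewrite mulrC divfK ?sqrf_eq0 ?gt_eqF // -det_tr; apply/eqP/det0P.
  exists x^T.
    apply/eqP => /(congr1 trmx); rewrite trmxK trmx0 => x0.
    by move/eqP: x1; rewrite x0 vnorm0 eq_sym oner_eq0.
  rewrite -trmx_mul mulmxBl -scalemxAl Sx scalerA -rmorphM mulfV ?gt_eqF //.
  by rewrite rmorph1 scale1r subrr trmx0.
rewrite -(@ler_pXn2r _ 2) ?nnegrE ?sqrtr_ge0 //; last first.
  by rewrite divr_ge0 ?(ltW s_gt0) ?(ltW w_gt0).
rewrite sqr_tuple_norm.
apply: (@le_trans _ _ (\sum_i Normc.normc (w i 0) ^+ 2 * c ^+ 2)).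
  apply: ler_sum => i _; rewrite perturbation_ofK -exprMn.
  have wc : 0 <= Normc.normc (w i 0) * c by rewrite mulr_ge0 ?normc_ge0.
  rewrite ler_pXn2r ?nnegrE ?spectral_norm_ge0 //.
  apply: spectral_norm_le => // v.
  rewrite -scalemxAl vnormZ Normc.normcM normc_real //.
  have -> : Normc.normc (w i 0)^*%R = Normc.normc (w i 0).
    by case: (w i 0) => u t /=; rewrite sqrrN.
  by rewrite ler_wpM2l ?Sle.
rewrite -mulr_suml -sqr_vnorm le_eqVlt; apply/orP; left; apply/eqP.
by rewrite /c; field; rewrite gt_eqF.
Qed.
End Perturbation.

Theorem theorem3p2 (R : realType) (n d k : nat) (G : rmp R n d k)
    (lambda : R[i]) :
  (0 < n)%N ->
  ~ rmp_pole G lambda ->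
  (forall j : 'I_k, rmp_w G j lambda != 0) ->
  rmp_eval G lambda \in unitmx ->
  eta_sym G lambda = eta G lambda /\
  eta G lambda =
    (sigma_min (rmp_eval G lambda) / vnorm (rmp_weights G lambda))%:E.
Proof.
move=> n0 _ _ Gu; set r := (_ / _).
have lower S : (r%:E <= backward_error S G lambda)%E.
  apply: le_ereal_inf_tmp => _ [D [_ D0] <-].
  by rewrite lee_fin; apply: sigma_min_le_tuple_norm.
have [D [Dsym D0 Dle]] := exists_optimal_symmetric n0 Gu.
have upper S : S D -> (backward_error S G lambda <= r%:E)%E.
  move=> SD; apply: (@le_trans _ _ (tuple_norm D)%:E); last by rewrite lee_fin.
  by apply: ereal_inf_lbound; exists D.
have value S : S D -> backward_error S G lambda = r%:E.
  by move=> SD; apply/eqP; rewrite eq_le upper // lower.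
by rewrite /eta_sym /eta !value.
Qed.
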